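(* Let $F$ be a field of characteristic two and let $A=(a_{jk})$ be a $3\times 3$ matrix over $F$ with $\Delta := a_{12}a_{23}a_{31}+a_{13}a_{32}a_{21}\neq 0$. Let $\mathcal P$ be the linear operator on $\mathsf V_1\oplus\mathsf V_2\oplus\mathsf V_3$ (with $\mathsf V_i=F^4$) defined by the $2\times2\times2$ block of copies of $A$, and let $\mathsf e^{(i)}_1,\mathsf e^{(i)}_2,\mathsf e^{(i)}_3,\mathsf e^{(i)}_4$ be the bases of $\mathsf V_i$ ($i=1,2,3$) given by $$\begin{pmatrix}\mathsf e^{(1)}_1\\ \mathsf e^{(1)}_2\\ \mathsf e^{(1)}_3\\ \mathsf e^{(1)}_4\end{pmatrix}=\mathrm G_{13}\otimes \mathrm G_{12},\qquad \begin{pmatrix}\mathsf e^{(2)}_2\\ \mathsf e^{(2)}_1\\ \mathsf e^{(2)}_3\\ \mathsf e^{(2)}_4\end{pmatrix}=\mathrm G_{23}\otimes \mathrm G_{21},\qquad \begin{pmatrix}\mathsf e^{(3)}_3\\ \mathsf e^{(3)}_1\\ \mathsf e^{(3)}_2\\ \mathsf e^{(3)}_4\end{pmatrix}=\mathrm G_{32}\otimes \mathrm G_{31}.$$ Let $x^{(i)}_j$ be the coordinates of a vector of $\mathsf V_1\oplus\mathsf V_2\oplus\mathsf V_3$ with respect to the vectors $\mathsf e^{(i)}_j$, and let $\tilde A=(a_{jk}^2)$. Then $\mathcal P$ acts on these coordinates by $$\begin{pmatrix}x^{(1)}_j& x^{(2)}_j& x^{(3)}_j\end{pmatrix}\mapsto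 \begin{pmatrix}x^{(1)}_j& x^{(2)}_j& x^{(3)}_j\end{pmatrix}\tilde A\quad (j=1,2,3),\qquad \begin{pmatrix}x^{(1)}_4& x^{(2)}_4& x^{(3)}_4\end{pmatrix}\mapsto \begin{pmatrix}x^{(1)}_4& x^{(2)}_4& x^{(3)}_4\end{pmatrix}\bigl(\tilde A\bigr)^{\mathrm T}.$$
   Context: Vectors are rows and matrices act from the right. $m_{jk}$ denotes the determinant of $A$ with the $j$-th row and $k$-th column deleted, and for $i\ne j$ $$\mathrm G_{ij}=\begin{pmatrix}a_{ij}& m_{ji}\\ a_{ji}& m_{ij}\end{pmatrix},\qquad \det\mathrm G_{ij}=\Delta,$$ so that the listed vectors do form bases when $\Delta\ne0$. $\otimes$ is the usual Kronecker product: rows and columns of $X\otimes Y$ for $2\times2$ matrices $X,Y$ are ordered as $(0,0),(0,1),(1,0),(1,1)$, the first index belonging to $X$. The displayed equalities mean that the rows of the $4\times4$ matrix on the right are, in order, the row vectors listed on the left (note the order in which the vectors are listed). The block operator $\mathcal P$: vertices are $v=(v_1,v_2,v_3)\in\{0,1\}^3$. For each direction $i\in\{1,2,3\}$ there are variables $s_i(v)\in F$ for $v$ with $v_i\in\{0,1,2\}$ and the other two components in $\{0,1\}$; for $v_i\in\{0,1\}$, $s_i(v)$ sits on the edge parallel to the $i$-th axis entering the vertex $v$, and $s_i(v)$ with $v_i=2$ sits on an outgoing edge of the block. With $\epsilon_i$ the $i$-th unit vector, at each vertex $v\in\{0,1\}^3$ $$\begin{pmatrix}s_1(v+\epsilon_1)&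 s_2(v+\epsilon_2)& s_3(v+\epsilon_3)\end{pmatrix}=\begin{pmatrix}s_1(v)& s_2(v)& s_3(v)\end{pmatrix}A .$$ Thus the 12 inputs ($s_i(v)$ with $v_i=0$) determine linearly the 12 outputs ($s_i(v)$ with $v_i=2$). For each $i$, let $j<k$ be the two other axes; the four inputs (respectively outputs) in direction $i$ are written as a row vector in $\mathsf V_i=F^4$ in the order $(v_j,v_k)=(0,0),(0,1),(1,0),(1,1)$. $\mathcal P$ is the resulting linear map from inputs to outputs, both regarded as elements of $\mathsf V_1\oplus\mathsf V_2\oplus\mathsf V_3$. *)

(* Defs.v *)
From HB Require Import structures.
From mathcomp Require Import all_boot all_algebra.
From mathcomp Require Export mxtens.

Set Implicit Arguments.
Unset Strict Implicit.
Unset Printing Implicit Defensive.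

Import GRing.Theory.
Local Open Scope ring_scope.

(* Axes 1, 2, 3 are the ordinals 0, 1, 2 : 'I_3, and matrix entries are
   likewise numbered from 0.  Vectors are rows, matrices act from the right. *)

Section Matrices.

Variables (F : fieldType) (A : 'M[F]_3).

Definition minor (j k : 'I_3) : F := \det (row' j (col' k A)).

Definition G (i j : 'I_3) : 'M[F]_2 :=
  \matrix_(r, c) if r == 0 then (if c == 0 then A i j else minor j i)
                 else (if c == 0 then A j i else minor i j).

Definition Delta : F :=
  A 0 1 * A 1 2%:R * A 2%:R 0 + A 0 2%:R * A 2%:R 1 * A 1 0.

Definition Atilde : 'M[F]_3 := map_mx (fun a => a ^+ 2) A.

(* The j-th entry of [ebasis i] is the vector e_(j+1) of V_(i+1).  The rows of
   the three Kronecker products are, in order, e_1 e_2 e_3 e_4 for the first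
   axis, e_2 e_1 e_3 e_4 for the second one and e_3 e_1 e_2 e_4 for the third
   one; the tuples below list them by increasing index. *)
Definition ebasis (i : 'I_3) : 4.-tuple 'rV[F]_4 :=
  let K0 : 'M[F]_4 := G 0 2%:R *t G 0 1 in
  let K1 : 'M[F]_4 := G 1 2%:R *t G 1 0 in
  let K2 : 'M[F]_4 := G 2%:R 1 *t G 2%:R 0 in
  if i == 0 then
    [tuple row 0 K0; row 1 K0; row 2%:R K0; row 3%:R K0]
  else if i == 1 then
    [tuple row 1 K1; row 0 K1; row 2%:R K1; row 3%:R K1]
  else
    [tuple row 1 K2; row 2%:R K2; row 0 K2; row 3%:R K2].

End Matrices.

(* The direct sum V_1 + V_2 + V_3, each summand being F^4. *)
Notation V3 F := {ffun 'I_3 -> 'rV[F]_4}.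

(* The coordinates of index j along the three axes. *)
Definition xcoord (F : fieldType) (A : 'M[F]_3) (u : V3 F) (j : 'I_4) :
    'rV[F]_3 :=
  \row_i coord (ebasis A i) j (u i).

Section Block.

Variables (F : fieldType) (A : 'M[F]_3).

(* A family of edge variables is s : 'I_3 -> 'rV[nat]_3 -> F, where [s i v] is
   s_i(v); only the positions v with v_i <= 2 and the other components <= 1
   belong to the block. *)
Definition block_state (s : 'I_3 -> 'rV[nat]_3 -> F) : Prop :=
  forall v : 'rV[nat]_3, (forall l, (v ord0 l < 2)%N) ->
    \row_i s i (v + delta_mx ord0 i) = (\row_i s i v) *m A.

(* The position v with v_i = c and (v_j, v_k) the p-th pair in the order
   (0,0), (0,1), (1,0), (1,1), where j < k are the two axes other than i. *)
Definition edge_pos (i : 'I_3) (c : nat) (p : 'I_(2 * 2)) : 'rV[nat]_3 :=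
  \row_l (if unlift i l is Some r then
            if r == 0 then nat_of_ord (mxtens_unindex p).1
            else nat_of_ord (mxtens_unindex p).2
          else c).

Definition edge_index (i : 'I_3) (v : 'rV[nat]_3) : 'I_(2 * 2) :=
  mxtens_index (inord (v ord0 (lift i 0)), inord (v ord0 (lift i 1))).

Definition inputs (s : 'I_3 -> 'rV[nat]_3 -> F) : V3 F :=
  [ffun i => \row_p s i (edge_pos i 0 p)].

Definition outputs (s : 'I_3 -> 'rV[nat]_3 -> F) : V3 F :=
  [ffun i => \row_p s i (edge_pos i 2 p)].

Definition prevv (i : 'I_3) (v : 'rV[nat]_3) : 'rV[nat]_3 :=
  \row_l (v ord0 l - (l == i))%N.

(* s_i(v) computed from the inputs u; n is fuel, and n = v_1 + v_2 + v_3 is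
   always enough. *)
Fixpoint flow_rec (n : nat) (u : V3 F) (i : 'I_3) (v : 'rV[nat]_3) : F :=
  if n is n'.+1 then
    if v ord0 i == 0%N then u i 0 (edge_index i v)
    else \sum_k flow_rec n' u k (prevv i v) * A k i
  else u i 0 (edge_index i v).

Definition flow (u : V3 F) (i : 'I_3) (v : 'rV[nat]_3) : F :=
  flow_rec (\sum_l v ord0 l)%N u i v.

Definition block_fun (u : V3 F) : V3 F := outputs (flow u).

Lemma flow_rec_linear n a u w i v :
  flow_rec n (a *: u + w) i v = a * flow_rec n u i v + flow_rec n w i v.
Proof.
elim: n i v => [|n IHn] i v /=; first by rewrite !ffunE !mxE.
case: ifP => _; first by rewrite !ffunE !mxE.
rewrite mulr_sumr -big_split /=; apply: eq_bigr => k _.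
by rewrite IHn mulrDl mulrA.
Qed.

Lemma block_fun_linear : linear block_fun.
Proof.
move=> a u w; apply/ffunP => i; rewrite !ffunE; apply/rowP => p.
by rewrite !mxE /flow flow_rec_linear.
Qed.

HB.instance Definition _ :=
  GRing.isLinear.Build F (V3 F) (V3 F) *:%R block_fun block_fun_linear.

Definition block_op : 'End(V3 F) := linfun block_fun.

Lemma sum_addv (v : 'rV[nat]_3) i :
  (\sum_l (v + delta_mx ord0 i)%R ord0 l = (\sum_l v ord0 l).+1)%N.
Proof.
under eq_bigr do rewrite !mxE /=.
rewrite big_split /= -[RHS]addn1; congr (_ + _)%N.
by rewrite (bigD1 i) //= eqxx big1 // => l /negbTE ->.
Qed.

Lemma prevvK (v : 'rV[nat]_3) i : prevv i (v + delta_mx ord0 i) = v.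
Proof.
apply/rowP => l; rewrite !mxE /=.
by case: (l == i); rewrite /= ?addrK; [exact: addnK | rewrite subn0 addr0].
Qed.

Lemma prevvD (v : 'rV[nat]_3) i : v ord0 i != 0%N -> prevv i v + delta_mx ord0 i = v.
Proof.
move=> vi; apply/rowP => l; rewrite !mxE /=.
case: eqP => [->|_] /=; last by rewrite subn0 addr0.
by apply: subnK; rewrite lt0n.
Qed.

Lemma edge_posK i c p : edge_index i (edge_pos i c p) = p.
Proof.
rewrite -[RHS]mxtens_unindexK /edge_index !mxE !liftK eqxx.
case: (mxtens_unindex p) => a b /=; rewrite inord_val.
by congr (mxtens_index (_, _)); rewrite inord_val.
Qed.

Lemma edge_indexK i (v : 'rV[nat]_3) :
  (forall l, l != i -> v ord0 l < 2)%N -> edge_pos i (v ord0 i) (edge_index i v) = v.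
Proof.
move=> v2; apply/rowP => l; rewrite mxE.
case: unliftP => [r|] -> //; rewrite /edge_index mxtens_indexK /=.
have lt2 t : (v ord0 (lift i t) < 2)%N by apply: v2; rewrite eq_sym neq_lift.
case: eqP => [->|r0]; first by rewrite inordK.
suff -> : r = 1 by rewrite inordK.
by apply: val_inj; case: r r0 => [[|[|//]] lt_r] // []; apply: val_inj.
Qed.

Lemma flow_state u : block_state (flow u).
Proof.
move=> v _; apply/rowP => i; rewrite !mxE /flow sum_addv /= prevvK.
have -> : ((v + delta_mx ord0 i) ord0 i == 0%N) = false.
  by rewrite !mxE !eqxx /= addrC.
by apply: eq_bigr => k _; rewrite mxE.
Qed.

Lemma flow_inputs u : inputs (flow u) = u.
Proof.
apply/ffunP => i; rewrite ffunE; apply/rowP => p; rewrite mxE /flow.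
have e0 : edge_pos i 0 p ord0 i = 0%N by rewrite mxE unlift_none.
by case: (\sum_l _)%N => [|n] /=; rewrite ?e0 ?eqxx edge_posK.
Qed.

Lemma state_flow s i (v : 'rV[nat]_3) :
  block_state s -> (v ord0 i <= 2)%N -> (forall l, l != i -> v ord0 l < 2)%N ->
  s i v = flow (inputs s) i v.
Proof.
move=> sP; rewrite /flow; move def_n: (\sum_l _)%N => n.
elim: n i v def_n => [|n IHn] i v def_n vi v2 /=.
  have vi0 : v ord0 i = 0%N.
    by apply/eqP; rewrite -leqn0 -[X in (_ <= X)%N]def_n (bigD1 i) //= leq_addr.
  by rewrite ffunE mxE -{1}(edge_indexK v2) vi0.
case: eqP => [vi0|/eqP vi0]; first by rewrite ffunE mxE -{1}(edge_indexK v2) vi0.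
have w2 l : (prevv i v ord0 l < 2)%N.
  rewrite mxE; case: eqP => [->|/eqP /v2]; last by rewrite subn0.
  by rewrite subn1; case: (v ord0 i) vi => [|[|[|]]].
have /rowP/(_ i) := sP _ w2; rewrite !mxE prevvD // => ->.
apply: eq_bigr => k _; rewrite mxE; congr (_ * _); apply: IHn => //.
  by apply/eqP; rewrite -eqSS -(sum_addv _ i) prevvD // def_n.
exact: ltnW.
Qed.

(* [flow_state], [flow_inputs] and [block_opP] together say that every input
   vector extends to a solution of the vertex equations and that [block_op]
   maps the inputs of any solution to its outputs. *)
Lemma block_opP s : block_state s -> block_op (inputs s) = outputs s.
Proof.
move=> sP; rewrite lfunE /=; apply/ffunP => i; rewrite !ffunE.
apply/rowP => p; rewrite !mxE; apply/esym/state_flow => // [|l li].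
  by rewrite mxE unlift_none.
by rewrite mxE; case: unliftP li => [r|] -> //; [case: ifP | rewrite eqxx].
Qed.

End Block.

(* Main.v *)
Require Import Defs.
From HB Require Import structures.
From mathcomp Require Import all_boot all_algebra.
From Stdlib Require Import Ring.

Set Implicit Arguments.
Unset Strict Implicit.
Unset Printing Implicit Defensive.

Import GRing.Theory.
Local Open Scope ring_scope.

(** Each basis vector is a tensor product of two vectors (a_ij, m_ji), the rows
    of the matrices G_ij.  For fixed j, the operator maps a combination
    x_1 e^(1)_j + x_2 e^(2)_j + x_3 e^(3)_j to a combination of the same three
    vectors: propagating the inputs through the eight vertices turns this into
    polynomial identities in the x_i and the entries of A, which hold in
    characteristic two without any condition on Delta.  Delta only enters
    through det G_ij = Delta, which makes the vectors bases. *)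

(** * Axes, Kronecker product entries and explicit positions in the block *)

Lemma ord3_ind (P : 'I_3 -> Prop) : P 0 -> P 1 -> P 2%:R -> forall i, P i.
Proof.
move=> P0 P1 P2 [[|[|[|//]]] i3].
- by have <- : 0 = Ordinal i3 :> 'I_3 by exact: val_inj.
- by have <- : 1 = Ordinal i3 :> 'I_3 by exact: val_inj.
- by have <- : 2%:R = Ordinal i3 :> 'I_3 by exact: val_inj.
Qed.

Lemma ord3E : ((0 : 'I_3) = 0%N :> nat) * ((1 : 'I_3) = 1%N :> nat) *
  ((2%:R : 'I_3) = 2%N :> nat).
Proof. by []. Qed.

Lemma big_ord3 (V : nmodType) (f : 'I_3 -> V) :
  \sum_i f i = f 0 + f 1 + f 2%:R.
Proof.
rewrite !big_ord_recl big_ord0 addr0 addrA.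
by congr (_ + f _ + f _); apply: val_inj.
Qed.

Lemma bumpE : (bump 0 0 = 1%N) * (bump 0 1 = 2%N) * (bump 1 0 = 0%N) *
  (bump 1 1 = 2%N) * (bump 2 0 = 0%N) * (bump 2 1 = 1%N).
Proof. by []. Qed.

Lemma det_mx2 (R : comPzRingType) (M : 'M[R]_2) :
  \det M = M 0 0 * M 1 1 - M 0 1 * M 1 0.
Proof.
rewrite (expand_det_row _ 0) !big_ord_recl big_ord0 addr0 /cofactor.
rewrite !det_mx11 !mxE.
rewrite /= expr0 expr1 mul1r mulN1r mulrN.
do ?[congr (_ + _) || congr (- _) || congr (_ * _)].
all: by congr (M _ _); apply: val_inj.
Qed.

Lemma row_tensE (R : pzRingType) (X Y : 'M[R]_2) (r s p q : 'I_2) (t : 'I_4) :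
  t = (r * 2 + s)%N :> nat ->
  row t (X *t Y) 0 (mxtens_index (p, q)) = X r p * Y s q.
Proof.
move=> def_t; have -> : t = @mxtens_index 2 2 (r, s) by apply: val_inj.
by rewrite !mxE !mxtens_indexK.
Qed.

Definition vertex (a b c : nat) : 'rV[nat]_3 := \row_l nth 0%N [:: a; b; c] l.

Lemma vertexD0 a b c : vertex a b c + delta_mx ord0 0 = vertex a.+1 b c.
Proof.
apply/rowP; elim/ord3_ind; rewrite !mxE /=.
all: by first [exact: addn1 | exact: addn0].
Qed.

Lemma vertexD1 a b c : vertex a b c + delta_mx ord0 1 = vertex a b.+1 c.
Proof.
apply/rowP; elim/ord3_ind; rewrite !mxE /=.
all: by first [exact: addn1 | exact: addn0].
Qed.

Lemma vertexD2 a b c : vertex a b c + delta_mx ord0 2%:R = vertex a b c.+1.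
Proof.
apply/rowP; elim/ord3_ind; rewrite !mxE /=.
all: by first [exact: addn1 | exact: addn0].
Qed.

Lemma edge_pos0 c (p q : 'I_2) : edge_pos 0 c (mxtens_index (p, q)) = vertex c p q.
Proof.
by apply/rowP => l; rewrite !mxE mxtens_indexK; case: unliftP => [[[|[|//]] r2]|] ->.
Qed.

Lemma edge_pos1 c (p q : 'I_2) : edge_pos 1 c (mxtens_index (p, q)) = vertex p c q.
Proof.
by apply/rowP => l; rewrite !mxE mxtens_indexK; case: unliftP => [[[|[|//]] r2]|] ->.
Qed.

Lemma edge_pos2 c (p q : 'I_2) : edge_pos 2%:R c (mxtens_index (p, q)) = vertex p q c.
Proof.
by apply/rowP => l; rewrite !mxE mxtens_indexK; case: unliftP => [[[|[|//]] r2]|] ->.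
Qed.

(* Polynomial arithmetic in characteristic two *)
Declare Scope char2_scope.
Delimit Scope char2_scope with c2.

Section Char2.

Variable F : fieldType.
Hypothesis charF : 2%N \in [pchar F].

(* The tactic [ring] selects its ring by the syntactic carrier of the terms,
   which for the generic operations depends on the head symbol. *)
Definition addF (x y : F) : F := x + y.
Definition mulF (x y : F) : F := x * y.

Arguments addF (x y)%_c2.
Arguments mulF (x y)%_c2.
Local Notation "x + y" := (addF x y) : char2_scope.
Local Notation "x * y" := (mulF x y) : char2_scope.

Lemma char2_ring_theory :
  ring_theory (0 : F) 1 addF mulF (fun x y => x - y) -%R eq.
Proof.
split=> *; rewrite /addF /mulF ?add0r ?mul1r ?addrA ?mulrA ?mulrDl ?subrr //.
- exact: addrC.
- exact: mulrC.
Qed.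

(** Coefficients are taken in the two-element field, [xorb] being addition, so that [ring] cancels
    equal monomials in pairs and ignores signs. *)
Definition F2_morph (b : bool) : F := if b then 1 else 0.

Lemma F2_morphP :
  ring_morph (0 : F) 1 addF mulF (fun x y => x - y) -%R eq
    false true xorb andb xorb id Bool.eqb F2_morph.
Proof.
split=> // [[] []|[] []|[] []|[]|[] []] //=; rewrite /addF /mulF;
  by rewrite ?(oppr_pchar2 charF) ?(addrr_pchar2 charF) ?addr0 ?add0r
             ?mulr0 ?mul0r ?mulr1.
Qed.

Add Ring char2_ring : char2_ring_theory (morphism F2_morphP).

(** * Matrices and basis vectors in terms of the entries of [A] *)

Variable A : 'M[F]_3.

Definition a (i j : nat) : F := A (inord i) (inord j).

Lemma coefE i j : A i j = a i j.
Proof. by rewrite /a !inord_val. Qed.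

(* (w i j 0, w i j 1) is the vector (a_ij, m_ji), the minor m_ji being expanded
   without its sign. *)
Definition w (i j c : nat) : F :=
  (if c == 0%N then a i j else
     a (bump j 0) (bump i 0) * a (bump j 1) (bump i 1)
     + a (bump j 0) (bump i 1) * a (bump j 1) (bump i 0))%c2.

Lemma GE i j (r c : 'I_2) : G A i j r c = if r == 0 then w i j c else w j i c.
Proof.
by rewrite mxE /minor !det_mx2 !mxE !coefE !(oppr_pchar2 charF).
Qed.

Lemma DeltaE : Delta A = (a 0 1 * a 1 2 * a 2 0 + a 0 2 * a 2 1 * a 1 0)%c2.
Proof. by rewrite /Delta !coefE. Qed.

(** With k the third axis, a_ij m_ij and a_ji m_ji share the monomial a_ij a_ji a_kk, which cancels;
    the two 3-cycles remain. *)
Lemma det_G i j : i != j -> \det (G A i j) = Delta A.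
Proof.
rewrite det_mx2 !GE DeltaE (oppr_pchar2 charF) -/(addF _ _) -!/(mulF _ _).
elim/ord3_ind: i; elim/ord3_ind: j => // _; rewrite !ord3E /w /= !bumpE; ring.
Qed.

(* The tensor factor of e^(i)_m along the axis l, where n is the third axis
   (everything being numbered from 0). *)
Definition factor (i m l n : nat) : nat -> F :=
  if (m == i) || (m == l) then w i n else w n i.

(** One formula in [m] absorbs the three different row orders of the Kronecker products; the first
    factor belongs to the smaller of the two other axes. *)
Lemma ebasisE (i : 'I_3) m (p q : 'I_2) : (m < 4)%N ->
  (ebasis A i)`_m 0 (mxtens_index (p, q)) =
    (factor i m (bump i 0) (bump i 1) p * factor i m (bump i 1) (bump i 0) q)%c2.
Proof.
elim/ord3_ind: i; case: m => [|[|[|[|//]]]] _; rewrite /=.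
all: first [ rewrite (@row_tensE _ _ _ 0 0); last by []
           | rewrite (@row_tensE _ _ _ 0 1); last by []
           | rewrite (@row_tensE _ _ _ 1 0); last by []
           | rewrite (@row_tensE _ _ _ 1 1); last by []].
all: by rewrite !GE.
Qed.

Lemma mulmx_AtildeE (x : 'rV[F]_3) (i : 'I_3) : (x *m Atilde A) 0 i =
  (x 0 0 * (a 0 i * a 0 i) + x 0 1 * (a 1 i * a 1 i)
   + x 0 2%:R * (a 2 i * a 2 i))%c2.
Proof. by rewrite mxE big_ord3 !mxE !coefE !expr2. Qed.

Lemma mulmx_tr_AtildeE (x : 'rV[F]_3) (i : 'I_3) : (x *m (Atilde A)^T) 0 i =
  (x 0 0 * (a i 0 * a i 0) + x 0 1 * (a i 1 * a i 1)
   + x 0 2%:R * (a i 2 * a i 2))%c2.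
Proof. by rewrite mxE big_ord3 !mxE !coefE !expr2. Qed.

(** * Propagation through the block *)

Lemma state_step s b c d (i : 'I_3) (v := vertex b c d) :
    block_state A s -> (b < 2)%N -> (c < 2)%N -> (d < 2)%N ->
  s i (v + delta_mx ord0 i) =
    (s 0 v * a 0 i + s 1 v * a 1 i + s 2%:R v * a 2 i)%c2.
Proof.
move=> sP b2 c2 d2.
have v2 l : (v ord0 l < 2)%N by rewrite mxE; case: l => [[|[|[|//]]] l3].
by have /rowP/(_ i) := sP _ v2; rewrite !mxE big_ord3 !mxE !coefE.
Qed.

Definition ebasis_comb (m : nat) (x : 'rV[F]_3) : V3 F :=
  [ffun i => x 0 i *: (ebasis A i)`_m].

Lemma block_ebasis m (x : 'rV[F]_3) : (m < 4)%N ->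
  block_op A (ebasis_comb m x) =
    ebasis_comb m (x *m if (m < 3)%N then Atilde A else (Atilde A)^T).
Proof.
move=> m4; have := flow_inputs A (ebasis_comb m x).
have := flow_state A (ebasis_comb m x).
(* The flow is forgotten except for its vertex equations and its inputs. *)
move: (flow A _) => s sP sI; rewrite -{1}sI (block_opP sP).
have S0 b c d (b2 : (b < 2)%N) (c2 : (c < 2)%N) (d2 : (d < 2)%N) :=
  etrans (congr1 (s 0) (esym (vertexD0 b c d))) (state_step 0 sP b2 c2 d2).
have S1 b c d (b2 : (b < 2)%N) (c2 : (c < 2)%N) (d2 : (d < 2)%N) :=
  etrans (congr1 (s 1) (esym (vertexD1 b c d))) (state_step 1 sP b2 c2 d2).
have S2 b c d (b2 : (b < 2)%N) (c2 : (c < 2)%N) (d2 : (d < 2)%N) :=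
  etrans (congr1 (s 2%:R) (esym (vertexD2 b c d))) (state_step 2%:R sP b2 c2 d2).
have I0 p q : (p < 2)%N -> (q < 2)%N -> s 0 (vertex 0 p q) =
    (x 0 0 * (factor 0 m 1 2 p * factor 0 m 2 1 q))%c2.
  move=> p2 q2; have /ffunP/(_ 0)/rowP := sI.
  move/(_ (mxtens_index (Ordinal p2, Ordinal q2))).
  by rewrite !ffunE !mxE edge_pos0 ebasisE.
have I1 p q : (p < 2)%N -> (q < 2)%N -> s 1 (vertex p 0 q) =
    (x 0 1 * (factor 1 m 0 2 p * factor 1 m 2 0 q))%c2.
  move=> p2 q2; have /ffunP/(_ 1)/rowP := sI.
  move/(_ (mxtens_index (Ordinal p2, Ordinal q2))).
  by rewrite !ffunE !mxE edge_pos1 ebasisE.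
have I2 p q : (p < 2)%N -> (q < 2)%N -> s 2%:R (vertex p q 0) =
    (x 0 2%:R * (factor 2 m 0 1 p * factor 2 m 1 0 q))%c2.
  move=> p2 q2; have /ffunP/(_ 2%:R)/rowP := sI.
  move/(_ (mxtens_index (Ordinal p2, Ordinal q2))).
  by rewrite !ffunE !mxE edge_pos2 ebasisE.
apply/ffunP; elim/ord3_ind; rewrite !ffunE; apply/rowP => pq; rewrite 2!mxE;
  case: (@mxtens_indexP 2 2 pq) => p q {pq};
  rewrite ?(edge_pos0, edge_pos1, edge_pos2) ebasisE // !ord3E.
all: case: p q => [[|[|//]] p2] [[|[|//]] q2]; simpl nat_of_ord.
(* Each vertex equation lowers the sum of the components by one, so every output unwinds to
   inputs. *)
all: rewrite !(S0, S1, S2) // !(I0, I1, I2) //.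
(* The outer product comes from the scaling in [ebasis_comb]; [ring] must see it as [mulF]. *)
all: rewrite -[RHS]/(mulF _ _).
(* Three axes, four outputs and four indices [m] give 48 identities. *)
all: case: m m4 {sI I0 I1 I2 S0 S1 S2 sP s} => [|[|[|[|//]]]] _; simpl leq; cbv iota.
all: rewrite ?mulmx_AtildeE ?mulmx_tr_AtildeE !ord3E !bumpE /factor /w /=.
all: rewrite ?bumpE.
all: ring.
Qed.

Lemma ebasis_basis i : Delta A != 0 -> basis_of fullv (ebasis A i).
Proof.
move=> nzD; have uG k l : k != l -> G A k l \in unitmx.
  by move=> kl; rewrite unitmxE det_G // unitfE.
(* The rows of an invertible [K] span, as v = (v K^-1) K, and four spanning vectors in dimension
   four form a basis. Stating this by membership in [X] makes the order of the rows irrelevant. *)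
have basisK (K : 'M[F]_4) (X : 4.-tuple 'rV[F]_4) :
    K \in unitmx -> (forall r, row r K \in X) -> basis_of fullv X.
  move=> uK sKX; rewrite basisEdim size_tuple dimvf /dim /= mul1n leqnn andbT.
  apply/subvP => v _; rewrite -(mulmxKV uK v) mulmx_sum_row.
  by apply: memv_suml => r _; apply/memvZ/memv_span/sKX.
have rowsK (K : 'M[F]_4) (X : 4.-tuple 'rV[F]_4) : row 0 K \in X -> row 1 K \in X ->
    row 2%:R K \in X -> row 3%:R K \in X -> forall r, row r K \in X.
  move=> X0 X1 X2 X3 [[|[|[|[|//]]]] r4].
  - by have <- : 0 = Ordinal r4 by exact: val_inj.
  - by have <- : 1 = Ordinal r4 by exact: val_inj.
  - by have <- : 2%:R = Ordinal r4 by exact: val_inj.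
  - by have <- : 3%:R = Ordinal r4 by exact: val_inj.
have uT k l m n : k != l -> m != n -> (G A k l *t G A m n : 'M[F]_4) \in unitmx.
  move=> kl mn.
  exact: (@tensmx_unit F 2 2 _ _ isT isT (uG _ _ kl) (uG _ _ mn)).
elim/ord3_ind: i.
- apply: (basisK (G A 0 2%:R *t G A 0 1)); first exact: uT.
  by apply: rowsK; rewrite !inE eqxx ?orbT.
- apply: (basisK (G A 1 2%:R *t G A 1 0)); first exact: uT.
  by apply: rowsK; rewrite !inE eqxx ?orbT.
- apply: (basisK (G A 2%:R 1 *t G A 2%:R 0)); first exact: uT.
  by apply: rowsK; rewrite !inE eqxx ?orbT.
Qed.

(** The expansions on the three axes are regrouped by common index [j], the form that [block_ebasis]
    treats. *)
Lemma ebasis_combE u : Delta A != 0 ->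
  u = \sum_(j < 4) ebasis_comb j (xcoord A u j).
Proof.
move=> nzD; apply/ffunP => i; rewrite sum_ffunE.
rewrite [LHS](coord_basis (ebasis_basis i nzD) (memvf (u i))).
by apply: eq_bigr => j _; rewrite !ffunE mxE.
Qed.

Lemma xcoord_comb (y : 'I_4 -> 'rV[F]_3) j : Delta A != 0 ->
  xcoord A (\sum_(k < 4) ebasis_comb k (y k)) j = y j.
Proof.
move=> nzD; apply/rowP => i; rewrite mxE sum_ffunE.
under eq_bigr do rewrite ffunE.
by rewrite coord_sum_free // (basis_free (ebasis_basis i nzD)).
Qed.

Lemma xcoord_block u (j : 'I_4) : Delta A != 0 ->
  xcoord A (block_op A u) j =
    xcoord A u j *m if (j < 3)%N then Atilde A else (Atilde A)^T.
Proof.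
move=> nzD; rewrite {1}(ebasis_combE u nzD) linear_sum /=.
under eq_bigr => k _ do rewrite block_ebasis //.
by rewrite (xcoord_comb (fun k : 'I_4 => _)).
Qed.

End Char2.

Theorem proposition1 (F : fieldType) (charF : 2%N \in [pchar F])
    (A : 'M[F]_3) (hDelta : Delta A != 0) :
  (forall i : 'I_3, basis_of fullv (ebasis A i)) /\
  (forall u : V3 F,
     (forall j : 'I_4, (j < 3)%N ->
        xcoord A (block_op A u) j = xcoord A u j *m Atilde A) /\
     xcoord A (block_op A u) ord_max = xcoord A u ord_max *m (Atilde A)^T).
Proof.
split=> [i|u]; first exact: ebasis_basis.
by split=> [j j3|]; rewrite xcoord_block // j3.
Qed.
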